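(* For any sequence of distinct points $A_1,A_2,\dots,A_n$ in the plane, one needs at least $n$ distance / angle / diagonal angle measurements to determine it up to plane isometry.
   Context: For a sequence of distinct points $A_1,\dots,A_n$ in the plane, the allowed measurements are: (1) distances $|A_iA_j|$, $i\ne j$; (2) angles $\angle A_iA_jA_k$ for $i,j,k$ distinct; (3) ''diagonal angles'' between $A_iA_j$ and $A_kA_l$. A set of such measurements determines the sequence up to plane isometry if any sequence of $n$ distinct points in the plane with the same corresponding measurements is congruent to $A_1,\dots,A_n$ (with points corresponding in the given order).
   Formalization: The claim is proved for sequences of at least three points; it fails for one point (no measurement is needed) and for two points (the single distance determines the pair). *)

(* Defs.v *)
From HB Require Import structures.
From mathcomp Require Import all_boot all_order all_algebra.
From mathcomp Require Import boolp classical_sets functions cardinality.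
From mathcomp Require Import reals trigo.

Set Implicit Arguments.
Unset Strict Implicit.
Unset Printing Implicit Defensive.

Import Order.TTheory GRing.Theory Num.Theory.
Local Open Scope ring_scope.

(* The library norm on 'rV[R]_2 is the sup norm, hence the explicit Euclidean
   structure on the plane. *)
Definition dot (R : realType) (u v : 'rV[R]_2) : R :=
  \sum_(k < 2) u ord0 k * v ord0 k.

Definition enorm (R : realType) (u : 'rV[R]_2) : R := Num.sqrt (dot u u).

Definition dist (R : realType) (P Q : 'rV[R]_2) : R := enorm (P - Q).

(* Unoriented, in [0, pi]; meaningful only for nonzero u and v. *)
Definition vangle (R : realType) (u v : 'rV[R]_2) : R :=
  acos (dot u v / (enorm u * enorm v)).

(* The side conditions are boolean, so two measurements with the same indices
   are equal. The same quantity may still have several names, such as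
   |A_i A_j| and |A_j A_i|. *)
Inductive measurement (n : nat) : Type :=
| Distance (i j : 'I_n) of i != j
| Angle (i j k : 'I_n) of [&& i != j, j != k & i != k]
| DiagonalAngle (i j k l : 'I_n) of (i != j) && (k != l).

(* Angle i j k has its vertex at A j. In DiagonalAngle the two segments are
   directed as written: the angle in [0, pi/2] between the undirected lines is
   a function of this one. *)
Definition measure (R : realType) (n : nat) (A : 'I_n -> 'rV[R]_2)
    (m : measurement n) : R :=
  match m with
  | Distance i j _ => dist (A i) (A j)
  | Angle i j k _ => vangle (A i - A j) (A k - A j)
  | DiagonalAngle i j k l _ => vangle (A j - A i) (A l - A k)
  end.

Definition plane_isometry (R : realType) (f : 'rV[R]_2 -> 'rV[R]_2) : Prop :=
  forall P Q, dist (f P) (f Q) = dist P Q.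

Definition congruent (R : realType) (n : nat) (A B : 'I_n -> 'rV[R]_2) : Prop :=
  exists2 f, plane_isometry f & forall i, B i = f (A i).

Definition determines (R : realType) (n : nat) (A : 'I_n -> 'rV[R]_2)
    (M : set (measurement n)) : Prop :=
  forall B : 'I_n -> 'rV[R]_2, injective B ->
    (forall m, M m -> measure B m = measure A m) -> congruent A B.

(* Main.v *)
(* Let A + V be a perturbation of A.  A measurement is preserved as soon as V
   satisfies two linear equations: V_i = V_j for a distance, and, for an angle,
   that each of its two sides be displaced parallel to itself.  Together with a
   normalisation V_0 = 0, a set of m < n measurements yields a linear map L from
   the 2n-dimensional space of displacements to a space of dimension
   2m + 2 <= 2n.  If L has a nonzero kernel, a small multiple of a kernel vector
   is a non-congruent perturbation.  Otherwise L is bijective; some measurement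
   is a distance |A_i A_j| since the kernel does not contain the homothety
   V = A - A_0, and one can solve for a V that rotates A_i - A_j by a small
   angle and satisfies the equations of all the other measurements.  As m >= 2,
   there is such another one, fixing the direction of a second segment, so the
   angle between the two segments varies. *)
Require Import Defs.
From HB Require Import structures.
From mathcomp Require Import all_boot all_order all_algebra.
From mathcomp Require Import boolp classical_sets functions cardinality.
From mathcomp Require Import reals trigo.
From mathcomp Require Import ring lra.

Set Implicit Arguments.
Unset Strict Implicit.
Unset Printing Implicit Defensive.

Import Order.TTheory GRing.Theory Num.Theory.

(** * Vectors, angles and rotations in the plane *)

Section Plane.
Local Open Scope ring_scope.
Variable R : realType.
Implicit Types (u v w : 'rV[R]_2) (a b s t : R).

Definition cross u v : R :=
  u ord0 ord0 * v ord0 ord_max - u ord0 ord_max * v ord0 ord0.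

(** Serves only to compare sizes; the l1 norm avoids square roots. *)
Definition norm1 u : R := `|u ord0 ord0| + `|u ord0 ord_max|.

Definition vec2 a b : 'rV[R]_2 := \row_c (if c == ord0 then a else b).

Definition rot90 u : 'rV[R]_2 := vec2 (- u ord0 ord_max) (u ord0 ord0).

Lemma rV2P u v :
  u ord0 ord0 = v ord0 ord0 -> u ord0 ord_max = v ord0 ord_max -> u = v.
Proof.
move=> e0 e1; apply/rowP => c.
have [->|c0] := eqVneq c ord0; first exact: e0.
suff -> : c = ord_max by exact: e1.
by apply/val_inj; case: c c0 => [[|[|c]]].
Qed.

Lemma dotE u v :
  dot u v = u ord0 ord0 * v ord0 ord0 + u ord0 ord_max * v ord0 ord_max.
Proof.
rewrite /dot big_ord_recl big_ord1.
by congr (_ + u _ _ * v _ _); apply/val_inj.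
Qed.

Lemma vec2E0 a b : vec2 a b ord0 ord0 = a.
Proof. by rewrite mxE. Qed.

Lemma vec2E1 a b : vec2 a b ord0 ord_max = b.
Proof. by rewrite mxE. Qed.

Definition coordE := (dotE, vec2E0, vec2E1, mxE).

Lemma vec2_eq0 a b : vec2 a b = 0 -> a = 0 /\ b = 0.
Proof.
by move=> e; rewrite -(vec2E0 a b) -{2}(vec2E1 a b) e !mxE.
Qed.

Lemma dot_ge0 u : 0 <= dot u u.
Proof. by rewrite dotE -!expr2 addr_ge0 ?sqr_ge0. Qed.

Lemma dot_eq0 u : dot u u = 0 -> u = 0.
Proof.
rewrite dotE => h.
by apply: rV2P; rewrite mxE; nra.
Qed.

Lemma norm1_gt0 u : u != 0 -> 0 < norm1 u.
Proof.
move=> u0; rewrite lt_def addr_ge0 // andbT; apply: contra u0.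
rewrite paddr_eq0 // !normr_eq0 => /andP[/eqP e0 /eqP e1].
by apply/eqP/rV2P; rewrite mxE.
Qed.

Lemma norm1Z a u : norm1 (a *: u) = `|a| * norm1 u.
Proof. by rewrite /norm1 !mxE !normrM mulrDr. Qed.

Lemma norm1D u v : norm1 (u + v) <= norm1 u + norm1 v.
Proof. by rewrite /norm1 !mxE addrACA lerD // ler_normD. Qed.

Lemma norm1_ge0 u : 0 <= norm1 u.
Proof. by rewrite addr_ge0. Qed.

Lemma norm1N u : norm1 (- u) = norm1 u.
Proof. by rewrite /norm1 !mxE !normrN. Qed.

(** The scalar is that of the orthogonal projection onto [u]. Its bound makes [1 + s] positive, so
    that [u + w] points in the direction of [u]. *)
Lemma parallel_small u w : cross w u = 0 -> norm1 w < norm1 u ->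
  exists2 s, w = s *: u & `|s| < 1.
Proof.
move=> c0 lt_wu.
have u_gt0 : 0 < norm1 u by apply: le_lt_trans lt_wu; apply: norm1_ge0.
have uu0 : dot u u != 0.
  apply/eqP => /dot_eq0 u0; move: u_gt0.
  by rewrite u0 /norm1 !mxE normr0 addr0 ltxx.
have e : w = (dot u w / dot u u) *: u.
  move: c0 uu0; rewrite /cross !coordE => /subr0_eq c0 uu0.
  by apply: rV2P; rewrite mxE; apply: (mulIf uu0); rewrite mulrAC divfK //;
    ring: c0.
exists (dot u w / dot u u) => //.
by move: lt_wu; rewrite {1}e norm1Z gtr_pMl.
Qed.

Lemma vangleZ a b u v : 0 < a -> 0 < b -> vangle (a *: u) (b *: v) = vangle u v.
Proof.
move=> a0 b0.
have enormZ c (x : 'rV[R]_2) : 0 < c -> enorm (c *: x) = c * enorm x.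
  move=> c0; rewrite /enorm.
  have -> : dot (c *: x) (c *: x) = c ^+ 2 * dot x x by rewrite !coordE; ring.
  by rewrite sqrtrM ?sqr_ge0// sqrtr_sqr gtr0_norm.
rewrite /vangle !enormZ //; congr acos.
have -> : dot (a *: u) (b *: v) = (a * b) * dot u v by rewrite !coordE; ring.
by rewrite mulrACA -mulf_div divff ?mul1r// mulf_neq0 ?gt_eqF.
Qed.

Lemma vangle_parallel u v w x :
  cross w u = 0 -> norm1 w < norm1 u -> cross x v = 0 -> norm1 x < norm1 v ->
  vangle (u + w) (v + x) = vangle u v.
Proof.
move=> cw lw cx lx.
have [s -> s1] := parallel_small cw lw; have [t -> t1] := parallel_small cx lx.
rewrite -{1}[u]scale1r -{1}[v]scale1r -!scalerDl vangleZ //.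
  by move: s1; rewrite ltr_norml => /andP[]; lra.
by move: t1; rewrite ltr_norml => /andP[]; lra.
Qed.

(* The rational parametrisation of rotations, with t the tangent of half the
   angle. *)
Lemma rotate_dot u t (tau := 2 * t / (1 + t ^+ 2)) :
  let u' := u + tau *: (rot90 u - t *: u) in dot u' u' = dot u u.
Proof.
have h : 1 + t ^+ 2 != 0 by rewrite gt_eqF// ltr_wpDr ?sqr_ge0.
rewrite /= /tau !coordE.
by field.
Qed.

End Plane.

(** * Displacements of the points and their effect on measurements *)

Section Perturbation.
Local Open Scope ring_scope.
Variables (R : realType) (n : nat).
Implicit Types (A B V : 'I_n -> 'rV[R]_2) (m : measurement n) (X : 'M[R]_(n, 2)).

(** One plane vector per measurement, whatever its kind, to fill one row of [system]. For angles its
    vanishing is sufficient but not necessary: a common rotation of both sides is excluded. *)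
Definition defect A m V : 'rV[R]_2 :=
  match m with
  | Distance i j _ => V i - V j
  | Angle i j k _ =>
      vec2 (cross (V i - V j) (A i - A j)) (cross (V k - V j) (A k - A j))
  | DiagonalAngle i j k l _ =>
      vec2 (cross (V j - V i) (A j - A i)) (cross (V l - V k) (A l - A k))
  end.

Definition small A V : Prop :=
  forall i j, i != j -> norm1 (V i - V j) < norm1 (A i - A j).

Lemma perturbB A V i j : (A \+ V) i - (A \+ V) j = (A i - A j) + (V i - V j).
Proof. by rewrite /= opprD addrACA. Qed.

Lemma defect_linear A m V W a b :
  defect A m (fun i => a *: V i + b *: W i) =
  a *: defect A m V + b *: defect A m W.
Proof. by case: m => *; apply: rV2P; rewrite /= /cross !coordE; ring. Qed.

Lemma small_injective A V : small A V -> injective (A \+ V).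
Proof.
move=> sV i j /eqP; rewrite -subr_eq0 perturbB addr_eq0 => /eqP e.
by apply: contraTeq isT => /sV; rewrite e norm1N ltxx.
Qed.

Lemma measure_perturb A V m :
  small A V -> defect A m V = 0 -> measure (A \+ V) m = measure A m.
Proof.
move=> sV; case: m => [i j ij|i j k ijk|i j k l ijkl] /=.
- by move=> e; rewrite /dist perturbB e addr0.
- case/and3P: (ijk) => ij jk _ /vec2_eq0[e1 e2].
  by rewrite !perturbB vangle_parallel ?sV // eq_sym.
- case/andP: (ijkl) => ij kl /vec2_eq0[e1 e2].
  by rewrite !perturbB vangle_parallel ?sV // eq_sym.
Qed.

(** Polarisation expresses the product through four squared distances, so no classification of
    isometries is required. *)
Lemma congruent_dot A B i j k l : congruent A B ->
  dot (B i - B j) (B k - B l) = dot (A i - A j) (A k - A l).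
Proof.
case=> f isof Bf.
have d2 p q : dot (B p - B q) (B p - B q) = dot (A p - A q) (A p - A q).
  have := isof (A p) (A q); rewrite -!Bf /dist /enorm => e.
  by rewrite -[LHS]sqr_sqrtr ?dot_ge0// e sqr_sqrtr ?dot_ge0.
have polar (P Q S T : 'rV[R]_2) : dot (P - Q) (S - T) =
    (dot (P - T) (P - T) + dot (Q - S) (Q - S)
     - dot (P - S) (P - S) - dot (Q - T) (Q - T)) / 2.
  by rewrite !coordE; field.
by rewrite polar !d2 -polar.
Qed.

Lemma uniform_scale A (F : 'I_n -> 'I_n -> R) :
  injective A -> (forall i j, 0 <= F i j) ->
  exists2 d, 0 < d <= 1 & forall i j, i != j -> d * F i j < norm1 (A i - A j).
Proof.
move=> injA F0; pose G i j := F i j / norm1 (A i - A j).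
have G0 i j : 0 <= G i j by rewrite divr_ge0 ?norm1_ge0.
have K0 : 0 <= \sum_i \sum_j G i j by do 2! apply: sumr_ge0 => ? _.
(* The sum bounds each of its nonnegative terms, so [d * G i j < 1] for all pairs at once. *)
exists (1 + \sum_i \sum_j G i j)^-1.
  by rewrite invr_gt0 invf_le1 ?lerDl ?ltr_wpDr.
move=> i j ij; have A0 : 0 < norm1 (A i - A j).
  by rewrite norm1_gt0 // subr_eq0 (inj_eq injA).
rewrite mulrC ltr_pdivrMr ?ltr_wpDr// mulrC -ltr_pdivrMr// -/(G i j).
rewrite (bigD1 i) //= (bigD1 j) //=.
have h1 : 0 <= \sum_(k | k != j) G i k by apply: sumr_ge0.
have h2 : 0 <= \sum_(l | l != i) \sum_k G l k.
  by do 2! apply: sumr_ge0 => ? _.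
lra.
Qed.

Lemma kernel_not_determines A (M : set (measurement n)) V i j :
  injective A -> (forall m, M m -> defect A m V = 0) -> V i != V j ->
  ~ determines A M.
Proof.
move=> injA VM Vij detM.
have [d /andP[d0 _] dP] :=
  @uniform_scale A (fun k l => norm1 (V k - V l)) injA (fun=> fun=> norm1_ge0 _).
have defectZ a m : defect A m (fun k => a *: V k) = a *: defect A m V.
  rewrite -[RHS]addr0 -[X in _ + X](scale0r (defect A m V)) -defect_linear.
  by congr defect; apply/funext => k; rewrite scale0r addr0.
(* Congruence preserves the squared length of [A i - A j]; after division by [a] the condition is
   affine in [a], and two values of [a] make its slope vanish. *)
have quad a : 0 < a <= d ->
    2 * dot (A i - A j) (V i - V j) + a * dot (V i - V j) (V i - V j) = 0.
  case/andP => a0 ad.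
  have sV : small A (fun k => a *: V k).
    move=> k l kl; rewrite -scalerBr norm1Z gtr0_norm//.
    by apply: le_lt_trans (dP _ _ kl); rewrite ler_wpM2r ?norm1_ge0.
  have cong : congruent A (A \+ fun k => a *: V k).
    apply: detM => [|m Mm]; first exact: small_injective.
    by apply: measure_perturb => //; rewrite defectZ VM // scaler0.
  have := congruent_dot i j i j cong; rewrite perturbB -scalerBr.
  move: (A i - A j) (V i - V j) => u v e.
  apply: (mulfI (lt0r_neq0 a0)); rewrite mulr0.
  by move: e; rewrite !coordE; lra.
have q1 : 0 < d <= d by rewrite d0 /=.
have q2 : 0 < d / 2 <= d by apply/andP; split; lra.
have : dot (V i - V j) (V i - V j) = 0 by move: (quad _ q1) (quad _ q2); nra.
by move/dot_eq0/eqP; rewrite subr_eq0; apply/negP.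
Qed.

(** Even a distance qualifies, since its defect is the whole relative displacement. This supplies
    the segment of fixed direction against which a rotated one is compared. *)
Lemma defect_cross A m : exists k l, k != l /\
  forall V, defect A m V = 0 -> cross (V k - V l) (A k - A l) = 0.
Proof.
case: m => [i j ij|i j k ijk|i j k l ijkl] /=.
- by exists i, j; split=> // V ->; rewrite /cross !mxE; ring.
- by case/and3P: ijk => ij _ _; exists i, j; split=> // V /vec2_eq0[].
- by case/andP: ijkl => ij _; exists j, i; split=> [|V /vec2_eq0[]//]; rewrite eq_sym.
Qed.

(* The linear combination tau V1 - tau t V2 rotates A_i - A_j, see
   [rotate_dot]. *)
Lemma rotation_not_determines A (M : set (measurement n)) V1 V2 i j k l :
  injective A ->
  V1 i - V1 j = rot90 (A i - A j) -> V2 i - V2 j = A i - A j ->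
  i != j -> k != l ->
  (forall a b, cross (a *: V1 k + b *: V2 k - (a *: V1 l + b *: V2 l))
                     (A k - A l) = 0) ->
  (forall m, M m -> (exists ij, m = @Distance n i j ij) \/
     forall a b, defect A m (fun p => a *: V1 p + b *: V2 p) = 0) ->
  ~ determines A M.
Proof.
move=> injA V1ij V2ij ij kl par VM detM.
pose F p q := norm1 (V1 p - V1 q) + norm1 (V2 p - V2 q).
have F0 p q : 0 <= F p q by rewrite addr_ge0 ?norm1_ge0.
have [d /andP[d0 d1] dP] := uniform_scale injA F0.
set u := A i - A j; set v := A k - A l.
have u0 : u != 0 by rewrite subr_eq0 (inj_eq injA).
have v0 : v != 0 by rewrite subr_eq0 (inj_eq injA).
(* The bound on [t] gives [tau <= 2 * t <= d], and [tau * t <= d] since [d <= 1]. Equality of the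
   products with [v] before and after the rotation gives the equation. *)
have orth t : 0 < t <= d / 2 -> cross u v - t * dot u v = 0.
  case/andP => t0 td; pose tau := 2 * t / (1 + t ^+ 2).
  have tau0 : 0 < tau by rewrite divr_gt0 ?mulr_gt0// ltr_wpDr ?sqr_ge0.
  have taud : tau <= d.
    rewrite ler_pdivrMr; last by rewrite ltr_wpDr ?sqr_ge0.
    by rewrite mulrDr mulr1; have := sqr_ge0 t; nra.
  have taut : tau * t <= d by nra.
  pose V p := tau *: V1 p + (- (tau * t)) *: V2 p.
  have VB p q :
      V p - V q = tau *: (V1 p - V1 q) + (- (tau * t)) *: (V2 p - V2 q).
    by rewrite /V; apply: rV2P; rewrite !mxE; ring.
  have sV : small A V.
    move=> p q pq; apply: le_lt_trans (dP _ _ pq).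
    rewrite VB; apply: (le_trans (norm1D _ _)); rewrite !norm1Z normrN.
    rewrite (gtr0_norm tau0) (gtr0_norm (mulr_gt0 tau0 t0)) [leRHS]mulrDr.
    by rewrite lerD// ler_wpM2r ?norm1_ge0.
  have Vij : V i - V j = tau *: (rot90 u - t *: u).
    by rewrite VB V1ij V2ij; apply: rV2P; rewrite !mxE; ring.
  have cong : congruent A (A \+ V).
    apply: detM => [|m Mm]; first exact: small_injective.
    case: (VM m Mm) => [[? ->]|e]; last exact: measure_perturb sV (e _ _).
    by rewrite /= /dist /enorm perturbB Vij rotate_dot.
  have [s Vkl s1] := parallel_small (par tau (- (tau * t))) (sV _ _ kl).
  have vv0 : dot v v != 0 by apply: contra v0 => /eqP/dot_eq0 ->.
  (* The length of [v] is preserved, so [s] is 0 or -2, and [|s| < 1] excludes -2. *)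
  have s0 : s = 0.
    have := congruent_dot k l k l cong; rewrite perturbB Vkl -/v => e.
    have : (s * (s + 2)) * dot v v = 0 by move: e; rewrite !coordE; lra.
    move/eqP; rewrite !mulf_eq0 (negPf vv0) orbF => /orP[/eqP//|/eqP s2].
    by move: s1; rewrite ltr_norml => /andP[]; lra.
  have := congruent_dot i j k l cong.
  rewrite !perturbB Vkl s0 scale0r addr0 -/u -/v Vij => e.
  apply: (mulfI (lt0r_neq0 tau0)); rewrite mulr0.
  by move: e; rewrite /cross !coordE; lra.
have t1 : 0 < d / 2 <= d / 2 by apply/andP; split; lra.
have t2 : 0 < d / 4 <= d / 2 by apply/andP; split; lra.
have uv0 : dot u v = 0 by move: (orth _ t1) (orth _ t2); nra.
have cuv0 : cross u v = 0 by move: (orth _ t1); rewrite uv0; lra.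
(* By Lagrange's identity, nonzero vectors cannot be both orthogonal and parallel. *)
have : dot u u * dot v v = dot u v ^+ 2 + cross u v ^+ 2.
  by rewrite /cross !coordE; ring.
rewrite uv0 cuv0 expr0n /= addr0 => /eqP; rewrite mulf_eq0.
by case/orP => /eqP/dot_eq0/eqP; apply/negP.
Qed.

(** Row 0 removes translations; row [r + 1] carries the defect of [e r]. Matrices give both spaces
    explicit dimensions, [2n] and [2(m + 1)]. *)
Definition system A (m : nat) (e : 'I_m -> measurement n) (i0 : 'I_n) X :
    'M[R]_(m.+1, 2) :=
  \matrix_(r < m.+1)
    (if unlift ord0 r is Some r' then defect A (e r') (fun i => row i X) else row i0 X).

Lemma system_linear A (m : nat) (e : 'I_m -> measurement n) i0 :
  linear (system A e i0).
Proof.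
move=> a X Y; apply/row_matrixP => r; rewrite linearP /= !rowK.
case: unlift => [r'|]; last exact: linearP.
rewrite -[defect _ _ (fun i => row i Y)]scale1r -defect_linear.
by congr defect; apply/funext => i; rewrite linearP scale1r.
Qed.

HB.instance Definition _ A (m : nat) (e : 'I_m -> measurement n) i0 :=
  GRing.isLinear.Build R _ _ _ _ (system_linear A e i0).

Lemma system0P A (m : nat) (e : 'I_m -> measurement n) i0 X :
  reflect (row i0 X = 0 /\ forall r, defect A (e r) (fun i => row i X) = 0)
          (system A e i0 X == 0).
Proof.
apply: (iffP eqP) => [e0|[X0 Xe]].
  split=> [|r].
    by have := congr1 (row ord0) e0; rewrite rowK unlift_none row0.
  by have := congr1 (row (lift ord0 r)) e0; rewrite rowK liftK row0.
by apply/row_matrixP => r; rewrite rowK row0; case: unliftP.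
Qed.

Lemma few_not_determines A (m : nat) (e : 'I_m -> measurement n) :
  (3 <= n)%N -> (m < n)%N -> injective A -> ~ determines A (range e).
Proof.
move=> n3 mn injA.
pose i0 := Ordinal (ltn_trans (ltn0Sn 1) n3).
pose i1 := Ordinal (ltn_trans (ltnSn 1) n3).
pose L := linfun (system A e i0).
have LE X : L X = system A e i0 X by rewrite lfunE.
have [/eqP kerL|kerL] := boolP (lker L == 0%VS); last first.
  have := memv_pick (lker L); move: kerL; rewrite -vpick0 memv_ker LE.
  move: (vpick _) => X X0 /system0P[Xi0 Xe].
  (* Row [i0] vanishes, so any nonzero row yields two points with different displacements. *)
  have [i Xi|X00] := pselect (exists i, row i X != 0); last first.
    case/negP: X0; apply/eqP/row_matrixP => i; rewrite row0; apply/eqP.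
    by apply: contra_notT X00 => Xi; exists i.
  case: i Xi => i Xi.
  apply: (@kernel_not_determines A _ (fun i => row i X) i i0) => //.
    by move=> _ [r _ <-].
  by rewrite Xi0.
(* Injectivity gives [2n <= 2(m + 1)]; with [m < n] this is an equality, hence [L] is onto. *)
have dimL : \dim (limg L) = (n * 2)%N.
  by rewrite limg_dim_eq ?kerL ?capv0// dimvf dim_matrix.
have nm : n = m.+1.
  have := dimvS (subvf (limg L)); rewrite dimL dimvf dim_matrix leq_pmul2r // => h.
  by apply/eqP; rewrite eqn_leq h.
have surjL (Y : 'M[R]_(m.+1, 2)) : exists X, system A e i0 X = Y.
  have limgL : limg L = fullv.
    by apply/eqP; rewrite eqEdim subvf dimL dimvf dim_matrix nm /=.
  have : Y \in limg L by rewrite limgL memvf.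
  by case/memv_imgP => X _ ->; exists X; rewrite LE.
have [[r [i [j [ij er]]]]|noD] :=
    pselect (exists r i j ij, e r = @Distance n i j ij); last first.
  (* The homothety centred at [A i0] moves every side parallel to itself, so without distances it
     would be a nonzero kernel element. *)
  have : \matrix_i (A i - A i0) \in lker L.
    rewrite memv_ker LE; apply/system0P; split=> [|r].
      by rewrite rowK subrr.
    case er: (e r) => [i j ij|i j k ijk|i j k l ijkl] /=.
    - by case: noD; exists r, i, j, ij.
    - by rewrite /cross; apply: rV2P; rewrite !coordE; ring.
    - by rewrite /cross; apply: rV2P; rewrite !coordE; ring.
  rewrite kerL memv0 => /eqP/(congr1 (row i1)); rewrite rowK row0 => /eqP.
  by rewrite subr_eq0 (inj_eq injA).
(* Prescribes the displacement of the segment measured by [e r] and cancels all other defects. *)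
pose target w : 'M[R]_(m.+1, 2) := \matrix_s (if s == lift ord0 r then w else 0).
have solve w : exists V, V i - V j = w /\
    forall s, s != r -> defect A (e s) V = 0.
  have [X XY] := surjL (target w); exists (fun i => row i X); split=> [|s sr].
    by have := congr1 (row (lift ord0 r)) XY; rewrite !rowK liftK eqxx er.
  have := congr1 (row (lift ord0 s)) XY.
  by rewrite !rowK liftK (inj_eq lift_inj) (negPf sr).
have [V1 [V1ij V1e]] := solve (rot90 (A i - A j)).
have [V2 [V2ij V2e]] := solve (A i - A j).
have comb s a b : s != r -> defect A (e s) (fun p => a *: V1 p + b *: V2 p) = 0.
  by move=> sr; rewrite defect_linear V1e// V2e// !scaler0 addr0.
(* Here [3 <= n = m + 1], so index 0 or index 1 differs from [r]. *)
have [s sr] : exists s, s != r.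
  have m2 : (1 < m)%N by rewrite -ltnS -nm.
  have [r0|r0] := eqVneq (val r) 0%N.
    by exists (Ordinal m2); apply/eqP => /(congr1 val); rewrite r0.
  by exists (Ordinal (ltnW m2)); apply: contra r0 => /eqP <-.
have [k [l [kl cr]]] := defect_cross A (e s).
apply: (@rotation_not_determines A _ V1 V2 i j k l) => //.
  by move=> a b; apply: (cr (fun p => a *: V1 p + b *: V2 p)); apply: comb.
move=> _ [s' _ <-]; have [->|s'r] := eqVneq s' r.
  by left; exists ij.
by right=> a b; apply: comb.
Qed.

End Perturbation.

(** * From finite families to arbitrary sets of measurements *)

Local Open Scope classical_set_scope.
Local Open Scope card_scope.

Theorem theorem3p9 (R : realType) (n : nat) (hn : (3 <= n)%N)
    (A : 'I_n -> 'rV[R]_2) (hA : injective A) (M : set (measurement n))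
    (hS : determines A M) :
  `I_n #<= M.
Proof.
apply: contrapT => nM.
(* An infinite [M] would contain a copy of the natural numbers, hence of [I_n]. *)
have [m Mm] : exists m, M #= `I_m.
  apply/finite_setP/finite_setPn => natM; apply: nM.
  exact: card_le_trans (subset_card_le (@subsetT _ _)) natM.
have /andP[leM geM] : (M #<= `I_m) && (`I_m #<= M) by rewrite -card_eq_le.
have mn : (m < n)%N.
  rewrite ltnNge -(card_le_II n m); apply/negP => nm; apply: nM.
  exact: card_le_trans nm geM.
have /ocard_geP[f] := leM.
pose i0 := Ordinal (ltn_trans (ltn0Sn 1) hn).
pose i1 := Ordinal (ltn_trans (ltnSn 1) hn).
(* The default only makes [e] total. It suffices that [range e] contains [M], because a larger set
   of measurements still determines [A]. *)
pose e (r : 'I_m) := odflt (@Distance n i0 i1 isT) (f r).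
apply: (@few_not_determines R n A m e hn mn hA) => B injB BA.
apply: hS => // p Mp; apply: BA.
have [r rm fr] : (f @` `I_m) (Some p).
  by apply: (@surj _ _ _ _ f); exists p.
by exists (Ordinal rm) => //; rewrite /e /= fr.
Qed.
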